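(* Let $k,m\ge 1$, let $p_1\ge\dots\ge p_r\ge 1$ and $q_1\ge\dots\ge q_s\ge 1$ be integers with $r,s\le m$ and $\sum_{i=1}^r p_i=\sum_{i=1}^s q_i=k$. Let $C_1=\operatorname{diag}(J_{p_1},\dots,J_{p_r})$ and $C_2=\operatorname{diag}(J_{q_1},\dots,J_{q_s})$ (both $k\times k$), let $D_1$ be the $k\times m$ matrix whose first $r$ columns form the block-diagonal matrix $\operatorname{diag}(e_{p_1},\dots,e_{p_r})$ and whose last $m-r$ columns are zero, and let $D_2$ be the $k\times m$ matrix whose first $s$ columns form the block-diagonal matrix $\operatorname{diag}(e_{q_1},\dots,e_{q_s})$ and whose last $m-s$ columns are zero. If the systems $\dot x(t)=C_1x(t)+D_1u(t)$ and $\dot y(t)=C_2y(t)+D_2v(t)$ are topologically equivalent, then they are linearly equivalent.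
   Context: $J_q$ is the $q\times q$ matrix with ones on the first superdiagonal and zeros elsewhere; $e_q=(0,\dots,0,1)^{\top}\in\mathbb{R}^q$ (a $q\times 1$ matrix). For real matrices $A$ ($k\times k$) and $B$ ($k\times m$), $(A,B)$ denotes the linear controlled system $\dot x(t)=Ax(t)+Bu(t)$, $t\ge 0$, with state $x(t)\in\mathbb{R}^k$ and control $u(t)\in\mathbb{R}^m$. Let $F(x,u)=(H(x),G(x,u))$ with $H:\mathbb{R}^k\to\mathbb{R}^k$ and $G:\mathbb{R}^k\times\mathbb{R}^m\to\mathbb{R}^m$ continuous. One says that $F$ brings $(A_1,B_1)$ to $(A_2,B_2)$ if for every $x^0\in\mathbb{R}^k$ and every $u\in C([0,+\infty);\mathbb{R}^m)$, whenever $x(t)$ is the solution of $(A_1,B_1)$ with $x(0)=x^0$ and control $u$, then $y(t)=H(x(t))$ is the solution of $(A_2,B_2)$ with $y(0)=H(x^0)$ and control $v(t)=G(x(t),u(t))$. Systems $(A_1,B_1)$ and $(A_2,B_2)$ are topologically equivalent if there is such an $F$ which is a homeomorphism of $\mathbb{R}^k\times\mathbb{R}^m$ onto itself, with inverse of the form $F^{-1}(y,v)=(H^{-1}(y),W(y,v))$, such that $F$ brings $(A_1,B_1)$ to $(A_2,B_2)$ and $F^{-1}$ brings $(A_2,B_2)$ to $(A_1,B_1)$. They are linearly equivalent if in addition $F$ can be chosen to be a linear isomorphism of $\mathbb{R}^k\times\mathbb{R}^m$ onto itself. *)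

(* Defs.v *)
From HB Require Import structures.
From mathcomp Require Import all_boot all_order all_algebra.
From mathcomp Require Import all_classical all_reals all_analysis.

Set Implicit Arguments.
Unset Strict Implicit.
Unset Printing Implicit Defensive.

Import Order.TTheory GRing.Theory Num.Theory.
Import numFieldNormedType.Exports.

Local Open Scope classical_set_scope.
Local Open Scope ring_scope.

(* Trajectories and controls are total functions on R, but only their values
   on [0, +oo[ are constrained. The limit is taken along s in [0, +oo[, s <> t,
   so at t = 0 it is the right derivative. *)
Definition is_solution (R : realType) (k m : nat)
    (A : 'M[R]_k) (B : 'M[R]_(k, m))
    (x0 : 'cV[R]_k) (u : R -> 'cV[R]_m) (x : R -> 'cV[R]_k) : Prop :=
  x 0 = x0 /\
  forall t : R, 0 <= t ->
    (s - t)^-1 *: (x s - x t) @[s --> within `[0, +oo[ t^'] -->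
      A *m x t + B *m u t.

Definition triangular_map (R : realType) (k m : nat)
    (H : 'cV[R]_k -> 'cV[R]_k) (G : 'cV[R]_k * 'cV[R]_m -> 'cV[R]_m)
    (z : 'cV[R]_k * 'cV[R]_m) : 'cV[R]_k * 'cV[R]_m :=
  (H z.1, G z).

Definition brings (R : realType) (k m : nat)
    (H : 'cV[R]_k -> 'cV[R]_k) (G : 'cV[R]_k * 'cV[R]_m -> 'cV[R]_m)
    (A1 : 'M[R]_k) (B1 : 'M[R]_(k, m))
    (A2 : 'M[R]_k) (B2 : 'M[R]_(k, m)) : Prop :=
  [/\ continuous H, continuous G &
    forall (x0 : 'cV[R]_k) (u : R -> 'cV[R]_m) (x : R -> 'cV[R]_k),
      {within `[0, +oo[, continuous u} ->
      is_solution A1 B1 x0 u x ->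
      is_solution A2 B2 (H x0) (fun t => G (x t, u t)) (fun t => H (x t))].

Definition homeomorphism (S T : topologicalType) (f : S -> T) (g : T -> S)
    : Prop :=
  [/\ continuous f, continuous g, cancel f g & cancel g f].

Definition equivalence_map (R : realType) (k m : nat)
    (A1 : 'M[R]_k) (B1 : 'M[R]_(k, m)) (A2 : 'M[R]_k) (B2 : 'M[R]_(k, m))
    (H : 'cV[R]_k -> 'cV[R]_k) (G : 'cV[R]_k * 'cV[R]_m -> 'cV[R]_m) : Prop :=
  exists (Hinv : 'cV[R]_k -> 'cV[R]_k) (W : 'cV[R]_k * 'cV[R]_m -> 'cV[R]_m),
    [/\ homeomorphism (triangular_map H G) (triangular_map Hinv W),
        cancel H Hinv, cancel Hinv H,
        brings H G A1 B1 A2 B2 & brings Hinv W A2 B2 A1 B1].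

Definition topologically_equivalent (R : realType) (k m : nat)
    (A1 : 'M[R]_k) (B1 : 'M[R]_(k, m))
    (A2 : 'M[R]_k) (B2 : 'M[R]_(k, m)) : Prop :=
  exists (H : 'cV[R]_k -> 'cV[R]_k) (G : 'cV[R]_k * 'cV[R]_m -> 'cV[R]_m),
    equivalence_map A1 B1 A2 B2 H G.

(* Bijectivity of the linear map is part of [equivalence_map]. *)
Definition linearly_equivalent (R : realType) (k m : nat)
    (A1 : 'M[R]_k) (B1 : 'M[R]_(k, m))
    (A2 : 'M[R]_k) (B2 : 'M[R]_(k, m)) : Prop :=
  exists (H : 'cV[R]_k -> 'cV[R]_k) (G : 'cV[R]_k * 'cV[R]_m -> 'cV[R]_m),
    equivalence_map A1 B1 A2 B2 H G /\ linear (triangular_map H G).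

Definition shift_mx (R : realType) (q : nat) : 'M[R]_q :=
  \matrix_(i < q, j < q) ((j : nat) == i.+1)%:R.

Definition last_col (R : realType) (q : nat) : 'cV[R]_q :=
  \col_(i < q) (i.+1 == q)%:R.

Definition blockC (R : realType) (k r : nat) (p : 'I_r -> nat)
    (pk : (\sum_(i < r) p i)%N = k) : 'M[R]_k :=
  castmx (pk, pk) (\mxdiag_(i < r) shift_mx R (p i)).

(* The i-th block of rows carries e_(p i) in column i and zeros elsewhere, so
   the first r columns form diag(e_(p 0), ..., e_(p (r - 1))) and the last
   m - r columns vanish. *)
Definition blockD (R : realType) (k m r : nat) (p : 'I_r -> nat)
    (pk : (\sum_(i < r) p i)%N = k) (rm : (r <= m)%N) : 'M[R]_(k, m) :=
  castmx (pk, erefl m)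
    (\mxcol_(i < r) (last_col R (p i) *m delta_mx 0 (widen_ord rm i))).

(* Main.v *)
Require Import Defs.
From HB Require Import structures.
From mathcomp Require Import all_boot all_order all_algebra.
From mathcomp Require Import all_classical all_reals all_analysis.
From mathcomp Require Import ring lra zify.

(** Both systems are families of [m] chains of integrators, a zero column of
    the control matrix counting as a chain of length [0].  Call level of a
    coordinate the number of integrations that separate it from the control of
    its chain: the controls have level [0], and a chain of length [n] has states
    at levels [1], ..., [n].  State and control together form a matrix indexed by
    chains and levels, on which [(H, G)] acts as a homeomorphism [Phi].  Since
    [H] carries trajectories to trajectories, the derivative of a level-[l]
    output along a trajectory is the level-[l.-1] output of the same chain; only
    trajectories with constant control are ever used.  The chain lengths [P] and
    [Q] are recovered from [Phi] by three observations.

    - Level-[l] outputs depend only on the inputs of level at least [l]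
      ([chain_map_levels]).  A velocity of size [e^-1] at level [d.-1], kept
      during a time [e], displaces level [d] by a finite amount and leaves the
      higher levels almost unchanged; an output whose derivative does not see
      level [d.-1] varies by [O(e)] meanwhile, so it does not see level [d].

    - Let the level-[l.-1] inputs switch between [B + D] and [B - D].  If the
      switching follows the Thue-Morse pattern, whose first moments vanish, the
      levels above end exactly where the constant input [B] would have brought
      them.  The level-[l] outputs, which see only these levels, then have equal
      increments; dividing by the duration and letting it tend to [0] gives
      [g (B + D) + g (B - D) = g B *+ 2] for every level-[l.-1] output [g] of a
      chain that reaches level [l] ([chain_map_midpoint]).  Being continuous, [g]
      is affine in the level-[l.-1] inputs.

    - Differentiating the first observation along trajectories, the level-[d]
      outputs of the chains longer than [d] depend only on the chains longer
      than [d] ([chain_map_long]).  Applied to the inverse of [Phi], this shows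
      that the affine map from the level-[d] inputs of the chains longer than
      [d] to the corresponding outputs is injective.

    Comparing dimensions, at least as many chains of the target as of the source
    are longer than [d] ([chain_map_count]), and the inverse homeomorphism gives
    the converse inequality.  These numbers determine the nonincreasing sequences
    [p] and [q], so the two systems are equal. *)

Set Implicit Arguments.
Unset Strict Implicit.
Unset Printing Implicit Defensive.

Import Order.TTheory GRing.Theory Num.Theory.
Import numFieldNormedType.Exports.

Local Open Scope classical_set_scope.
Local Open Scope ring_scope.

(** * Limits of matrices *)

Lemma cvg_mx (R : numFieldType) (T : Type) (F : set_system T) {FF : Filter F}
    (m n : nat) (f : T -> 'M[R]_(m, n)) (l : 'M[R]_(m, n)) :
  (forall i j, f x i j @[x --> F] --> l i j) -> f x @[x --> F] --> l.
Proof.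
move=> fl A [P lP sPA].
suff: \forall x \near F, forall i j, P i j (f x i j) by apply: filterS => x; exact: sPA.
by apply: filter_forall => i; apply: filter_forall => j; exact: fl (lP i j).
Qed.

Lemma cvg_entry (R : numFieldType) (T : Type) (F : set_system T) {FF : Filter F}
    (m n : nat) (f : T -> 'M[R]_(m, n)) (l : 'M[R]_(m, n)) i j :
  f x @[x --> F] --> l -> f x i j @[x --> F] --> l i j.
Proof.
move=> fl; apply: (@continuous_cvg _ _ _ _ _ _ (fun M : 'M[R]_(m, n) => M i j)) fl.
exact: coord_continuous.
Qed.

Lemma cvg_fin_sum (R : numFieldType) (T : Type) (F : set_system T) {FF : Filter F}
    (I : finType) (f : I -> T -> R) (l : I -> R) :
  (forall i, f i x @[x --> F] --> l i) ->
  \sum_i f i x @[x --> F] --> \sum_i l i.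
Proof.
by move=> fl; apply: (@cvg_big _ _ +%R 0 xpredT) => //; exact: add_continuous.
Qed.

Lemma cvg_mulmx (R : numFieldType) (T : Type) (F : set_system T) {FF : Filter F}
    (m n p : nat) (f : T -> 'M[R]_(m, n)) (g : T -> 'M[R]_(n, p)) (a : 'M[R]_(m, n))
    (b : 'M[R]_(n, p)) :
  f x @[x --> F] --> a -> g x @[x --> F] --> b -> f x *m g x @[x --> F] --> a *m b.
Proof.
move=> fa gb; apply: cvg_mx => i j; rewrite mxE.
under eq_fun do rewrite mxE.
by apply: cvg_fin_sum => c; apply: cvgM; exact: cvg_entry.
Qed.

(** * The flow of a chain of integrators *)

Section Flow.
Variables (R : realType) (k : nat).

(** The exponential of [t] times the shift that sends each level to the next.
    Rows of states are multiplied by it on the right, so that one matrix serves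
    all the chains. *)
Definition flow_mx (t : R) : 'M[R]_k.+1 :=
  \matrix_(a, b) (t ^+ (b - a) / (b - a)`!%:R *+ (a <= b)%N).

Lemma flow_mx0 : flow_mx 0 = 1%:M.
Proof.
apply/matrixP => a b; rewrite !mxE expr0n.
rewrite subn_eq0; case: (ltngtP a b) => [ab|ab|/val_inj->]; rewrite ?mul0r ?mul0rn //.
- by rewrite (_ : (a == b) = false) // -val_eqE /= ltn_eqF.
- by rewrite mulr0n (_ : (a == b) = false) // -val_eqE /= gtn_eqF.
- by rewrite subnn fact0 divr1 eqxx.
Qed.

Lemma flow_mx_continuous : continuous flow_mx.
Proof.
move=> t; apply: cvg_mx => a b; rewrite mxE.
under eq_fun do rewrite mxE.
case: (a <= b)%N; last by rewrite mulr0n; under eq_fun do rewrite mulr0n; exact: cvg_cst.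
rewrite mulr1n; under eq_fun do rewrite mulr1n.
by apply: cvgMl; exact: exprn_continuous.
Qed.

Lemma is_derive_flow_mx (t : R) (a b b' : 'I_k.+1) : b = b'.+1 :> nat ->
  is_derive t 1 (fun s => flow_mx s a b) (flow_mx t a b').
Proof.
move=> bb'; rewrite mxE.
have -> : (fun s => flow_mx s a b) =
    (((b - a)`!%:R^-1 *+ (a <= b)%N) \*: (@id R ^+ (b - a)) : R -> R).
  apply/funext => s; rewrite mxE /=.
  by case: (a <= b)%N; rewrite ?mulr0n ?mulr1n ?scale0r // fctE mulrC.
have D := is_deriveZ ((b - a)`!%:R^-1 *+ (a <= b)%N)
  (is_deriveX (b - a) (is_derive_id t 1)).
apply: (is_derive_eq D) => /=; rewrite /GRing.scale /= mulr1 {D}.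
case: (ltngtP a b) => ab.
- have -> : (a <= b')%N by lia.
  have -> : (b - a = (b' - a).+1)%N by lia.
  rewrite !mulr1n /= factS natrM invfM mulrACA.
  by rewrite mulVf ?pnatr_eq0 // mul1r mulrC.
- have -> : (a <= b')%N = false by lia.
  by rewrite !mulr0n mul0r.
- have -> : (a <= b')%N = false by lia.
  by rewrite (_ : (b - a = 0)%N) ?mul0r ?mulr0 //; lia.
Qed.

Lemma is_derive_flow (m : nat) (X : 'M[R]_(m, k.+1)) (t : R) i
    (b b' : 'I_k.+1) : b = b'.+1 :> nat ->
  is_derive t 1 (fun s => (X *m flow_mx s) i b) ((X *m flow_mx t) i b').
Proof.
move=> bb'; rewrite mxE.
have -> : (fun s => (X *m flow_mx s) i b) =
    \sum_(a < k.+1) (X i a \*: (fun s => flow_mx s a b) : R -> R).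
  by apply/funext => s; rewrite mxE fct_sumE.
by apply: is_derive_sum => a; apply: is_deriveZ; exact: is_derive_flow_mx.
Qed.

End Flow.

(** * Maps between chains that respect trajectories *)

Definition chain_agree (R : realType) (m k : nat) (P : 'I_m -> nat) (d : nat)
    (X Y : 'M[R]_(m, k.+1)) : Prop :=
  forall (i : 'I_m) (l : 'I_k.+1), (d <= l <= P i)%N -> X i l = Y i l.

(** All chains are stored with [k.+1] levels; in chain [i] only the levels up to
    [P i] are meaningful, and [chain_agree P d] compares the meaningful ones from
    [d] upwards.  The second condition says, for [d = 0], that outputs are
    functions of the meaningful inputs and, for [d = 1], that states of the target
    are functions of the states of the source alone. *)
Definition chain_map (R : realType) (m k : nat) (P Q : 'I_m -> nat)
    (Phi : 'M[R]_(m, k.+1) -> 'M[R]_(m, k.+1)) : Prop :=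
  [/\ continuous Phi,
      forall d X Y, (d <= 1)%N -> chain_agree P d X Y ->
        chain_agree Q d (Phi X) (Phi Y) &
      forall X (t : R) (j : 'I_m) (l l' : 'I_k.+1), 0 < t ->
        l = l'.+1 :> nat -> (l <= Q j)%N ->
        is_derive t 1 (fun s => Phi (X *m flow_mx k s) j l)
          (Phi (X *m flow_mx k t) j l')].

Section ChainMap.
Variables (R : realType) (m k : nat) (P Q : 'I_m -> nat).
Variable Phi : 'M[R]_(m, k.+1) -> 'M[R]_(m, k.+1).
Hypothesis PhiP : chain_map P Q Phi.
Local Notation M := (flow_mx k).

Lemma continuous_entry_flow (j : 'I_m) (l : 'I_k.+1) (X : 'M[R]_(m, k.+1)) :
  continuous (fun t : R => Phi (X *m M t) j l).
Proof.
case: PhiP => Phic _ _ t; apply: cvg_entry.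
apply: (@continuous_cvg _ _ _ _ _ _ Phi); first exact: Phic.
by apply: cvg_mulmx; [exact: cvg_cst|exact: flow_mx_continuous].
Qed.

Lemma chain_increment (X : 'M[R]_(m, k.+1)) (t : R) (j : 'I_m) (l l' : 'I_k.+1) : 0 < t ->
  l = l'.+1 :> nat -> (l <= Q j)%N ->
  exists2 c, 0 < c < t & Phi (X *m M t) j l - Phi X j l = Phi (X *m M c) j l' * t.
Proof.
move=> t0 ll' lQ; case: PhiP => Phic _ dPhi.
have [||c] := @MVT R (fun s => Phi (X *m M s) j l) (fun s => Phi (X *m M s) j l') 0 t t0.
- by move=> x; rewrite in_itv /= => /andP[x0 _]; exact: dPhi.
- by apply: continuous_subspaceT; exact: continuous_entry_flow.
- by rewrite in_itv /= flow_mx0 mulmx1 subr0 => c0t E; exists c.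
Qed.

(** The flow during time [th * e] applied to an input [e^-1 *: D] that lies
    below level [d], as seen from level [d] on, where the singularity at [e = 0]
    cancels: see [fast_mxE].  Its value at [e = 0], [th = 1] moves each level to the next one
    without reaching any further. *)
Definition fast_mx (e th : R) : 'M[R]_k.+1 :=
  \matrix_(a, b) (th * (th * e) ^+ (b - a.+1) / (b - a)`!%:R *+ (a < b)%N).

Lemma fast_mxE (d : nat) (e th : R) (D : 'M[R]_(m, k.+1)) i (l : 'I_k.+1) :
  e != 0 -> (forall i (a : 'I_k.+1), (d <= a)%N -> D i a = 0) -> (d <= l)%N ->
  ((e^-1 *: D) *m M (th * e)) i l = (D *m fast_mx e th) i l.
Proof.
move=> e0 D0 dl; rewrite !mxE; apply: eq_bigr => a _; rewrite !mxE.
have [da|ad] := leqP d a; first by rewrite D0 // mulr0 !mul0r.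
have -> : (a < l)%N by lia.
have -> : (a <= l)%N by lia.
have -> : (l - a = (l - a.+1).+1)%N by lia.
rewrite !mulr1n exprS [LHS](_ : _ = (e^-1 * e) *
  (D i a * (th * (th * e) ^+ (l - a.+1) / (l - a.+1).+1`!%:R))); last by ring.
by rewrite mulVf // mul1r.
Qed.

Lemma fast_mx_continuous : continuous (fun z : R * R => fast_mx z.1 z.2).
Proof.
move=> z; apply: cvg_mx => a b; rewrite mxE.
under eq_fun do rewrite mxE.
case: (a < b)%N; last by rewrite mulr0n; under eq_fun do rewrite mulr0n; exact: cvg_cst.
rewrite mulr1n; under eq_fun do rewrite mulr1n.
apply: cvgMl; apply: cvgM; first exact: cvg_snd.
apply: (@continuous_cvg _ _ _ _ _ _ (fun x : R => x ^+ (b - a.+1))).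
  exact: exprn_continuous.
by apply: cvgM; [exact: cvg_snd|exact: cvg_fst].
Qed.

(** To change level [d] of [X] into that of [Y], replace level [d.-1] by the
    difference divided by [e] and follow the flow during a time [e].  By induction
    the output and its derivative do not see the levels below [d].  The derivative
    stays bounded uniformly in [e], by compactness of the unit square of
    pairs [(e, th)], so the increment of the output tends to [0] while the endpoint
    tends to a matrix that agrees with [Y] from level [d] on. *)
Lemma chain_map_levels (d : nat) X Y :
  chain_agree P d X Y -> chain_agree Q d (Phi X) (Phi Y).
Proof.
elim: d X Y => [|d IH] X Y XY; first by case: PhiP => _ + _; apply.
case: (posnP d) => [d0|d_gt0].
  by move: XY; rewrite d0 => XY; case: PhiP => _ + _; apply.
move=> j l /andP[dl lQ].
pose l' : 'I_k.+1 := inord l.-1.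
have ll' : l = l'.+1 :> nat by rewrite inordK; have := ltn_ord l; lia.
have dl' : (d <= l')%N by lia.
have [dk|kd] := ltnP d k.+1; last by have := ltn_ord l; lia.
pose X0 : 'M[R]_(m, k.+1) := \matrix_(i, a) (X i a *+ (d <= a)%N).
pose D : 'M[R]_(m, k.+1) :=
  \matrix_(i, a) ((Y i (inord d) - X i (inord d)) *+ (a.+1 == d)).
have D0 i (a : 'I_k.+1) : (d <= a)%N -> D i a = 0.
  by move=> da; rewrite mxE gtn_eqF // ltnS.
pose W (z : R * R) := X0 *m M (z.2 * z.1) + D *m fast_mx z.1 z.2.
have Wc : continuous W.
  move=> z; apply: cvgD; apply: cvg_mulmx; try exact: cvg_cst.
    apply: (@continuous_cvg _ _ _ _ _ _ M); first exact: flow_mx_continuous.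
    by apply: cvgM; [exact: cvg_snd|exact: cvg_fst].
  exact: fast_mx_continuous.
case: (PhiP) => Phic _ _.
have PWc a : continuous (fun z => Phi (W z) j a).
  move=> z; apply: cvg_entry.
  by apply: (@continuous_cvg _ _ _ _ _ _ Phi); [exact: Phic|exact: Wc].
have WE e th : e != 0 ->
    chain_agree P d ((X0 + e^-1 *: D) *m M (th * e)) (W (e, th)).
  move=> e0 i a /andP[da _].
  by rewrite /W /= mulmxDl [LHS]mxE [RHS]mxE (@fast_mxE d).
have h0 e : Phi (X0 + e^-1 *: D) j l = Phi X j l.
  apply: (IH _ _ _ j l); last by rewrite (ltnW dl).
  by move=> i a /andP[da _]; rewrite !mxE da (gtn_eqF (_ : d < a.+1)%N) // mulr0 addr0.
have h1 : Phi (W (0, 1)) j l = Phi Y j l.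
  apply: (IH _ _ _ j l); last by rewrite (ltnW dl).
  move=> i a /andP[da aP]; rewrite /W /= mulr0 flow_mx0 mulmx1 !mxE da mulr1n.
  pose b : 'I_k.+1 := inord d.-1.
  have bd : b.+1 = d by rewrite inordK; lia.
  rewrite (bigD1 b) //= big1 ?addr0; last first.
    move=> c cb; rewrite !mxE; case: eqP => [cd|_]; last by rewrite mul0r.
    by case/eqP: cb; apply/val_inj; move: bd; rewrite -cd => -[].
  rewrite !mxE bd eqxx mulr1n mul1r mul1r.
  rewrite da mulr1n expr0n.
  case: (eqVneq d (nat_of_ord a)) => [ad|/eqP ad].
    have -> : inord d = a by apply: val_inj; rewrite /= inordK.
    have -> : (a - b = 1)%N by lia.
    by rewrite ad subnn eqxx divr1 mulr1 addrC subrK.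
  by rewrite (_ : (a - d == 0)%N = false) ?mul0r ?mulr0 ?addr0 ?XY //; lia.
pose K : set (R * R) := `[0, 1]%classic `*` `[0, 1]%classic.
have [] := @compact_EVT_max _ R (fun z => `|Phi (W z) j l'|) K.
- by exists (0, 0); split; rewrite /= in_itv /= lexx ler01.
- by apply: compact_setX; exact: segment_compact.
- apply: continuous_subspaceT => z.
  apply: (@continuous_cvg _ _ _ _ _ _ (@Num.norm R R)); first exact: norm_continuous.
  exact: PWc.
move=> z _ zmax; set B := `|_| in zmax.
have bound e : 0 < e < 1 -> `|Phi (W (e, 1)) j l - Phi X j l| <= e * B.
  move=> /andP[e_gt0 e_lt1]; have e0 : e != 0 by rewrite gt_eqF.
  have [c /andP[c0 ce]] := chain_increment (X0 + e^-1 *: D) e_gt0 ll' lQ.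
  have := WE e 1 e0; rewrite mul1r => /IH -> ; last by rewrite (ltnW dl).
  rewrite h0 => ->.
  have cE : c = c / e * e by rewrite divfK.
  rewrite cE (IH _ _ (WE e (c / e) e0) j l'); last by rewrite dl' /=; lia.
  rewrite normrM (gtr0_norm e_gt0) mulrC ler_pM2l // zmax // inE; split => /=.
    by rewrite in_itv /= !ltW.
  by rewrite in_itv /= divr_ge0 ?ler_pdivrMr ?mul1r ?ltW.
pose f e := Phi (W (e, 1)) j l - Phi X j l.
have fc : continuous f.
  move=> e; apply: cvgB; last exact: cvg_cst.
  apply: (@continuous_cvg _ _ _ _ _ _ (fun z => Phi (W z) j l)); first exact: PWc.
  apply: (@cvg_pair R R R (nbhs e) (nbhs e) (nbhs (1 : R)) _ _ _ id (fun=> 1)).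
    exact: cvg_id.
  exact: cvg_cst.
(* [f] is continuous and [`|f e| <= e * B] for small positive [e]. *)
have f0 : f 0 = 0.
  have cv : f e @[e --> 0^'+] --> f 0 by apply: cvg_at_right_filter; exact: fc.
  suff cv0 : f e @[e --> 0^'+] --> (0 : R).
    exact: (cvg_unique (@norm_hausdorff _ R) cv cv0).
  apply/norm_cvg0P; apply: (@squeeze_cvgr _ _ _ _ (fun=> 0) (fun e => e * B)).
  - near=> e; rewrite normr_ge0 bound //.
    apply/andP; split; near: e; [exact: nbhs_right_gt|exact: nbhs_right_lt].
  - exact: cvg_cst.
  - rewrite -[X in _ --> X](mul0r B); apply: cvgMl.
    by apply: cvg_at_right_filter; exact: cvg_id.
by apply/esym/eqP; rewrite -h1 -subr_eq0; apply/eqP.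
Unshelve. all: by end_near.
Qed.

(** The starting point is allowed to move with [t] so that the estimate can be
    chained along the pieces of a switching path. *)
Lemma chain_rate (j : 'I_m) (l l' : 'I_k.+1) (S : R -> 'M[R]_(m, k.+1)) S0 :
  l = l'.+1 :> nat -> (l <= Q j)%N -> S t @[t --> 0^'+] --> S0 ->
  (Phi (S t *m M t) j l - Phi (S t) j l) / t @[t --> 0^'+] --> Phi S0 j l'.
Proof.
move=> ll' lQ SS0.
have /choice[c cP] (t : R) : exists c, 0 < t ->
    0 < c < t /\ Phi (S t *m M t) j l - Phi (S t) j l = Phi (S t *m M c) j l' * t.
  have [t0|] := ltP 0 t; last by exists 0.
  by have [c c1 c2] := chain_increment (S t) t0 ll' lQ; exists c.
have ccvg : c t @[t --> 0^'+] --> (0 : R).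
  apply: (@squeeze_cvgr _ _ _ _ (fun=> 0) id).
  - near=> t; have t0 : 0 < t by near: t; exact: nbhs_right_gt.
    by have [/andP[/ltW -> /ltW ->]] := cP t t0.
  - exact: cvg_cst.
  - by apply: cvg_at_right_filter; exact: cvg_id.
have : Phi (S t *m M (c t)) j l' @[t --> 0^'+] --> Phi S0 j l'.
  apply: cvg_entry; case: (PhiP) => Phic _ _.
  apply: (@continuous_cvg _ _ _ _ _ _ Phi); first exact: Phic.
  rewrite -[S0]mulmx1 -(flow_mx0 R k); apply: cvg_mulmx => //.
  by apply: (@continuous_cvg _ _ _ _ _ _ M) => //; exact: flow_mx_continuous.
apply: cvg_trans; apply: near_eq_cvg; near=> t.
have t0 : 0 < t by near: t; exact: nbhs_right_gt.
by have [_ ->] := cP t t0; rewrite mulfK // gt_eqF.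
Unshelve. all: by end_near.
Qed.

(** The output is the derivative of the next output of its chain, which sees only
    levels above [l'].  The chains of length at most [l'] never influence these
    levels, nor do the inputs below level [l'] once they are set to [0]. *)
Lemma chain_map_long (j : 'I_m) (l' : 'I_k.+1) (X Y : 'M[R]_(m, k.+1)) :
  (l' < Q j)%N -> (l' < k)%N ->
  (forall i (a : 'I_k.+1), (l' < P i)%N -> (l' <= a <= P i)%N -> X i a = Y i a) ->
  Phi X j l' = Phi Y j l'.
Proof.
move=> lQ lk XY.
pose l : 'I_k.+1 := inord l'.+1.
have ll' : l = l'.+1 :> nat by rewrite inordK.
(* Levels below [l'] are invisible to this output, so they can be erased. *)
pose cut (Z : 'M[R]_(m, k.+1)) : 'M[R]_(m, k.+1) := \matrix_(i, a) (Z i a *+ (l' <= a)%N).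
have cutE Z : Phi Z j l' = Phi (cut Z) j l'.
  apply: (@chain_map_levels l' _ _ _ j l'); last by rewrite leqnn ltnW.
  by move=> i a /andP[la _]; rewrite mxE la.
rewrite cutE [RHS]cutE.
have lQ' : (l <= Q j)%N by rewrite ll'.
have lim Z : (Phi (cut Z *m M t) j l - Phi (cut Z) j l) / t @[t --> 0^'+] -->
    Phi (cut Z) j l'.
  by apply: (chain_rate ll' lQ'); exact: cvg_cst.
have flowE t : Phi (cut X *m M t) j l = Phi (cut Y *m M t) j l.
  apply: (@chain_map_levels l _ _ _ j l); last by rewrite leqnn.
  move=> i a /andP[la aP]; rewrite !mxE; apply: eq_bigr => c _; rewrite !mxE.
  have [ca|ac] := leqP c a; last by rewrite !mulr0n !mulr0.
  have [lc|] := leqP l' c; last by rewrite !mulr0n !mul0r.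
  by rewrite XY ?lc /=; [|lia|lia].
have flow0 : Phi (cut X) j l = Phi (cut Y) j l.
  by have := flowE 0; rewrite flow_mx0 !mulmx1.
apply: (cvg_unique (@norm_hausdorff _ R) (lim X)).
by move: (lim Y); under eq_fun do rewrite -flowE -flow0.
Qed.

(** * Thue-Morse switching *)

Section Midpoint.
Variables (j : 'I_m) (l l' : 'I_k.+1) (B : 'M[R]_(m, k.+1)).
Hypotheses (ll' : l = l'.+1 :> nat) (lQ : (l <= Q j)%N).
Definition at_level (X : 'M[R]_(m, k.+1)) := forall i (a : 'I_k.+1), a != l' -> X i a = 0.
Hypothesis BP : at_level B.

(** Levels below [l] are erased at the end of each piece of a path and replaced
    by the input chosen for the next one: the level-[l] output cannot tell. *)
Definition cut_flow (t : R) : 'M[R]_k.+1 := \matrix_(a, b) (M t a b *+ (l <= b)%N).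

(** Endpoint of the path made of [2 ^ n] pieces of duration [t], with inputs
    [B + D] or [B - D] in the Thue-Morse order, [b] telling the sign of the first
    one; the second half of the path is the first one with signs exchanged. *)
Fixpoint thue_morse (n : nat) (b : bool) (D : 'M[R]_(m, k.+1)) (t : R)
    (S : 'M[R]_(m, k.+1)) :=
  if n is n'.+1 then thue_morse n' (~~ b) D t (thue_morse n' b D t S)
  else (S + (B + (-1) ^+ b *: D)) *m cut_flow t.

Definition vanish (a : nat) (X : 'M[R]_(m, k.+1)) :=
  forall i (c : 'I_k.+1), (c < a)%N -> X i c = 0.

(** If a half path sends [S] to [S *m A + V + W], its opposite sends [S] to
    [S *m A + V - W], hence their composition perturbs the endpoint by
    [W *m A - W].  As [A] is unipotent with respect to the filtration by levels,
    each doubling of the path lifts the perturbation by one level. *)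
Lemma thue_morse_affine n t : exists (A : 'M[R]_k.+1) (V : 'M[R]_(m, k.+1)),
  (forall a X, (l <= a)%N -> vanish a X -> vanish a.+1 (X *m A - X)) /\
  forall D, exists2 W, vanish (l + n) W &
    forall b S, thue_morse n b D t S = S *m A + V + (-1) ^+ b *: W.
Proof.
elim: n => [|n [A [V [AP DP]]]].
  exists (cut_flow t), (B *m cut_flow t); split.
    move=> a X la X0 i c ca; rewrite !mxE.
    rewrite (bigD1 c) //= big1 ?addr0.
      rewrite !mxE leqnn subnn fact0 expr0 divr1.
      have [cla|ac] := ltnP c a; first by rewrite X0 // mul0r subr0.
      by rewrite (leq_trans la ac) mulr1 subrr.
    move=> e ec; rewrite !mxE; have [ea|ae] := ltnP e a; first by rewrite X0 ?mul0r.
    rewrite (_ : (e <= c)%N = false) ?mul0rn ?mulr0 //.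
    by apply/negbTE; rewrite -ltnNge; move: ec; rewrite -val_eqE /=; lia.
  move=> D; exists (D *m cut_flow t).
    move=> i c; rewrite addn0 mxE => cl; rewrite big1 // => e _.
    by rewrite !mxE [(l <= c)%N]leqNgt cl mulr0.
  by move=> b S /=; rewrite !mulmxDl -scalemxAl addrA.
exists (A *m A), (V *m A + V); split.
  move=> a X la X0; have X1 := AP a X la X0.
  (* With [E := X *m A - X], this is [(E *m A - E) + E + E]. *)
  have -> : X *m (A *m A) - X =
      (X *m A - X) *m A - (X *m A - X) + (X *m A - X) + (X *m A - X).
    rewrite mulmxBl mulmxA; move: (X *m A *m A) (X *m A) => U Z.
    by apply/matrixP => i c; rewrite !mxE; ring.
  have addV U Z : vanish a.+1 U -> vanish a.+1 Z -> vanish a.+1 (U + Z).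
    by move=> U0 Z0 i c ca; rewrite mxE U0 // Z0 // addr0.
  apply: (addV _ _ _ X1); apply: (addV _ _ _ X1); apply: AP => // i c ca.
  by apply: X1; exact: ltnW.
move=> D; have [W W0 WE] := DP D; exists (W *m A - W).
  by rewrite addnS; apply: AP => //; lia.
move=> b S /=; rewrite !WE !mulmxDl -scalemxAl mulmxA.
move: (S *m A *m A) (V *m A) (W *m A) => U Z Y.
by case: b => /=; apply/matrixP => i c; rewrite !mxE; ring.
Qed.

Lemma thue_morse_cancel n b D t S : (k < n)%N ->
  thue_morse n b D t S = thue_morse n b 0 t S.
Proof.
move=> kn; have [A [V [_ DP]]] := thue_morse_affine n t.
have W0 (W : 'M[R]_(m, k.+1)) : vanish (l + n) W -> W = 0.
  by move=> W0; apply/matrixP => i c; rewrite W0 ?mxE //; have := ltn_ord c; lia.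
have [W1 /W0-> ->] := DP D; have [W2 /W0-> ->] := DP 0.
by [].
Qed.

(** The rate at which the level-[l] output grows with [t] along the path. *)
Fixpoint tm_rate (n : nat) (b : bool) (D : 'M[R]_(m, k.+1)) : R :=
  if n is n'.+1 then tm_rate n' b D + tm_rate n' (~~ b) D
  else Phi (B + (-1) ^+ b *: D) j l'.

Lemma tm_rateE n b D : tm_rate n.+1 b D = 2 ^+ n * (Phi (B + D) j l' + Phi (B - D) j l').
Proof.
elim: n b => [|n IH] b; last first.
  rewrite [LHS]/= -/(tm_rate n.+1 b D) -/(tm_rate n.+1 (~~ b) D) !IH exprS.
  by ring.
by case: b; rewrite /= expr0 expr1 scale1r scaleN1r mul1r // addrC.
Qed.

Lemma tm_rate_cvg n b D (S : R -> 'M[R]_(m, k.+1)) : at_level D ->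
  S t @[t --> 0^'+] --> (0 : 'M[R]_(m, k.+1)) ->
  thue_morse n b D t (S t) @[t --> 0^'+] --> (0 : 'M[R]_(m, k.+1)) /\
  (Phi (thue_morse n b D t (S t)) j l - Phi (S t) j l) / t @[t --> 0^'+]
    --> tm_rate n b D.
Proof.
move=> DP; elim: n b S => [|n IH] b S S0.
  set V := B + (-1) ^+ b *: D.
  have VP : at_level V by move=> i a al; rewrite !mxE BP // DP // mulr0 addr0.
  have SV : S t + V @[t --> 0^'+] --> V.
    by rewrite -[X in _ --> X]add0r; apply: cvgD => //; exact: cvg_cst.
  have PhiV X : Phi (X + V) j l = Phi X j l.
    apply: (@chain_map_levels l _ _ _ j l); last by rewrite leqnn.
    move=> i a /andP[la _]; rewrite mxE VP ?addr0 //.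
    by apply/eqP => al; move: la; rewrite al ll' ltnn.
  split.
    rewrite (_ : 0 = V *m cut_flow 0); first apply: cvg_mulmx => //.
      apply: cvg_mx => a c; rewrite mxE; under eq_fun do rewrite mxE.
      case: (l <= c)%N; last first.
        by rewrite mulr0n; under eq_fun do rewrite mulr0n; exact: cvg_cst.
      rewrite mulr1n; under eq_fun do rewrite mulr1n; apply: cvg_entry.
      by apply: cvg_at_right_filter; exact: flow_mx_continuous.
    apply/esym/matrixP => i c; rewrite [LHS]mxE [RHS]mxE big1 // => a _.
    rewrite [cut_flow _ _ _]mxE flow_mx0 [1%:M _ _]mxE.
    have [->|al] := eqVneq a l'; last by rewrite VP // mul0r.
    have [lc|cl] := leqP l c; last by rewrite mulr0n mulr0.
    rewrite (_ : (l' == c) = false) ?mul0rn ?mulr0 //.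
    by apply/eqP => E; move: lc; rewrite ll' E ltnn.
  rewrite [X in X @ _](_ : _ =
      (fun t => (Phi ((S t + V) *m M t) j l - Phi (S t + V) j l) / t)).
    exact: chain_rate.
  apply/funext => t; rewrite PhiV; congr ((_ - _) / _).
  apply: (@chain_map_levels l _ _ _ j l); last by rewrite leqnn.
  move=> i a /andP[la _]; rewrite !mxE; apply: eq_bigr => c _.
  by rewrite [cut_flow _ _ _]mxE la.
have [S1 r1] := IH b S S0.
have [S2 r2] := IH (~~ b) _ S1; split=> //=.
rewrite [X in X @ _](_ : _ = (fun t =>
  (Phi (thue_morse n b D t (S t)) j l - Phi (S t) j l) / t +
  (Phi (thue_morse n (~~ b) D t (thue_morse n b D t (S t))) j l -
   Phi (thue_morse n b D t (S t)) j l) / t)); first exact: cvgD.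
by apply/funext => t; rewrite -mulrDl; congr (_ / _); rewrite /=; ring.
Qed.

(** The path with perturbation [D] and the path with perturbation [0] have the
    same endpoint, hence the same rate. *)
Lemma chain_map_midpoint D : at_level D ->
  Phi (B + D) j l' + Phi (B - D) j l' = Phi B j l' *+ 2.
Proof.
move=> DP.
have Z0 : at_level (0 : 'M[R]_(m, k.+1)) by move=> i a _; rewrite mxE.
have S0 : (fun=> 0 : 'M[R]_(m, k.+1)) t @[t --> (0 : R)^'+] --> (0 : 'M[R]_(m, k.+1)).
  exact: cvg_cst.
have [_ r1] := tm_rate_cvg k.+1 false DP S0.
have [_ r2] := tm_rate_cvg k.+1 false Z0 S0.
have : tm_rate k.+1 false D = tm_rate k.+1 false 0.
  apply: (cvg_unique (@norm_hausdorff _ R) r1).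
  rewrite [X in X @ _](_ : _ = (fun t : R =>
    (Phi (thue_morse k.+1 false 0 t 0) j l - Phi 0 j l) / t)) //.
  by apply/funext => t; rewrite thue_morse_cancel.
rewrite !tm_rateE addr0 subr0 => /mulfI; rewrite mulr2n; apply.
by rewrite expf_neq0 // pnatr_eq0.
Qed.

End Midpoint.
End ChainMap.

(** * Counting the chains longer than a given level *)

Lemma additive_continuous_linear (R : realType) (f : R -> R) :
  continuous f -> {morph f : x y / x + y} -> forall x, f x = x * f 1.
Proof.
move=> fc fD x.
have f0 : f 0 = 0 by have := fD 0 0; rewrite addr0; lra.
have fB : zmod_morphism f.
  by move=> u v; have := fD (u - v) v; rewrite subrK; lra.
pose F : {additive R -> R} := HB.pack f (GRing.isZmodMorphism.Build _ _ f fB).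
have frat (r : rat) : f (ratr r) = ratr r * f 1.
  have dn0 : (denq r)%:~R != 0 :> R by rewrite intr_eq0 denq_neq0.
  have fZ (z : int) y : f (z%:~R * y) = z%:~R * f y.
    by rewrite !mulrzl; exact: (raddfMz F z).
  apply: (mulfI dn0); rewrite -fZ /ratr mulrCA mulfV // mulr1.
  by rewrite -[X in f X]mulr1 fZ; field.
apply/eqP; apply: contrapT => /negP; rewrite -subr_eq0 => fx.
(* A point where [g] does not vanish would have rational neighbours alike. *)
pose g t := f t - t * f 1.
have [||t [/= gt0 [r _ rt]]] := @dense_rat R (g @^-1` [set~ 0]).
- by exists x; apply/eqP.
- apply: open_comp; last exact: closed_openC.
  move=> t _; apply: cvgB; first exact: fc.
  by apply: cvgMl; exact: cvg_id.
- by apply: gt0; rewrite /g -rt frat subrr.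
Qed.

Lemma midpoint_affine (R : realType) (a b : nat) (T : 'rV[R]_a -> 'rV[R]_b) :
  continuous T -> (forall c d, T (c + d) + T (c - d) = T c *+ 2) ->
  exists A : 'M[R]_(a, b), forall c, T c = T 0 + c *m A.
Proof.
move=> Tc Tmid; pose F c := T c - T 0.
(* The midpoint identity at [c = d = 2^-1 *: w]. *)
have Fhalf w : F w = F (2^-1 *: w) *+ 2.
  have := Tmid (2^-1 *: w) (2^-1 *: w).
  rewrite subrr -scalerDl (_ : 2^-1 + 2^-1 = 1 :> R) ?scale1r; last by field.
  by rewrite /F mulrnBl => <-; rewrite [T 0 *+ 2]mulr2n opprD addrA addrK.
have FD : {morph F : u v / u + v}.
  move=> u v; rewrite Fhalf.
  have := Tmid (2^-1 *: (u + v)) (2^-1 *: (u - v)).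
  rewrite -scalerDr -scalerBr.
  have -> : u + v + (u - v) = 2 *: u by apply/rowP => i; rewrite !mxE; ring.
  have -> : u + v - (u - v) = 2 *: v by apply/rowP => i; rewrite !mxE; ring.
  rewrite !scalerA mulVf ?pnatr_eq0 // !scale1r /F mulrnBl => <-.
  by rewrite [T 0 *+ 2]mulr2n opprD addrACA.
have FZ r c : F (r *: c) = r *: F c.
  apply/rowP => i; rewrite [RHS]mxE.
  rewrite -{2}[c]scale1r.
  apply: (@additive_continuous_linear R (fun r => F (r *: c) 0 i)).
    move=> x; apply: cvg_entry; apply: cvgB; last exact: cvg_cst.
    apply: (@continuous_cvg _ _ _ _ _ _ T); first exact: Tc.
    by apply: cvgZl; exact: cvg_id.
  by move=> x y; rewrite scalerDl FD mxE.
exists (\matrix_j F (delta_mx 0 j)) => c.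
rewrite mulmx_sum_row.
have F0 : F 0 = 0 by rewrite /F subrr.
have Fsum (I : finType) (u : I -> 'rV[R]_a) : F (\sum_i u i) = \sum_i F (u i).
  by rewrite (big_morph F FD F0).
transitivity (T 0 + F c); first by rewrite addrC subrK.
rewrite {1}[c]row_sum_delta Fsum; congr (_ + _); apply: eq_bigr => i _.
by rewrite FZ rowK.
Qed.

(** The level-[d] inputs of the chains longer than [d] are mapped to the level-[d]
    outputs of the chains longer than [d], all other inputs being [0].  This map
    is affine; it is injective because its value determines the level-[d] inputs
    through [Psi], the outputs of higher levels being constant. *)
Lemma chain_map_count (R : realType) (m k : nat) (P Q : 'I_m -> nat)
    (Phi Psi : 'M[R]_(m, k.+1) -> 'M[R]_(m, k.+1)) (d : nat) :
  (d < k)%N -> chain_map P Q Phi -> chain_map Q P Psi ->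
  (forall X, chain_agree P 0 (Psi (Phi X)) X) ->
  (#|[pred i | (d < P i)%N]| <= #|[pred j | (d < Q j)%N]|)%N.
Proof.
move=> dk PhiP PsiP PhiK.
set I := [pred i | _]; set J := [pred j | _].
have dk1 : (d < k.+1)%N by apply: ltnW.
pose l' : 'I_k.+1 := Ordinal dk1.
pose l : 'I_k.+1 := inord d.+1.
have ll' : l = l'.+1 :> nat by rewrite inordK.
pose emb (c : 'rV[R]_#|I|) : 'M[R]_(m, k.+1) :=
  \matrix_(i, a) (if a == l' then \sum_x c 0 x *+ (enum_val x == i) else 0).
have emb_in c x : emb c (enum_val x) l' = c 0 x.
  rewrite mxE eqxx (bigD1 x) //= eqxx big1 ?addr0 // => y yx.
  by rewrite (inj_eq enum_val_inj) (negbTE yx).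
have emb_level c : at_level l' (emb c).
  by move=> i a al; rewrite mxE (negbTE al).
have embD c c' : emb (c + c') = emb c + emb c'.
  apply/matrixP => i a; rewrite !mxE; case: eqP => _; last by rewrite addr0.
  rewrite -big_split; by apply: eq_bigr => x _; rewrite mxE mulrnDl.
have embN c : emb (- c) = - emb c.
  apply/matrixP => i a; rewrite !mxE; case: eqP => _; last by rewrite oppr0.
  rewrite -sumrN; by apply: eq_bigr => x _; rewrite mxE mulNrn.
have embc : continuous emb.
  move=> c; apply: (@cvg_mx R _ (nbhs c) (nbhs_filter c)) => i a; rewrite mxE.
  under eq_fun do rewrite mxE.
  case: (a == l'); last exact: cvg_cst.
  apply: (@cvg_fin_sum R _ (nbhs c) (nbhs_filter c)) => x.
  case: (enum_val x == i); last first.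
    by rewrite mulr0n; under eq_fun do rewrite mulr0n; exact: cvg_cst.
  by rewrite mulr1n; under eq_fun do rewrite mulr1n; exact: coord_continuous.
pose T (c : 'rV[R]_#|I|) : 'rV[R]_#|J| := \row_y Phi (emb c) (enum_val y) l'.
have Tc : continuous T.
  move=> c; apply: (@cvg_mx R _ (nbhs c) (nbhs_filter c)) => i y; rewrite mxE.
  under eq_fun do rewrite mxE.
  apply: (@cvg_entry R _ (nbhs c) (nbhs_filter c)); case: (PhiP) => Phic _ _.
  by apply: (@continuous_cvg _ _ _ _ _ _ Phi); [exact: Phic|exact: embc].
have [A TA] : exists A : 'M[R]_(#|I|, #|J|), forall c, T c = T 0 + c *m A.
  apply: midpoint_affine => // c c'; apply/rowP => y.
  rewrite mxE mulmxnE !mxE embD [emb (c - c')]embD embN.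
  apply: (chain_map_midpoint PhiP ll') => //.
  by have := enum_valP y; rewrite inE ll'.
suff : row_free A by move=> /eqP <-; exact: rank_leq_col.
apply/inj_row_free => v vA0.
have Tv : T v = T 0 by rewrite TA vA0 addr0.
apply/rowP => x; rewrite -emb_in -(emb_in 0).
have xP : (d < P (enum_val x))%N by have := enum_valP x; rewrite inE.
have lP : (0 <= l' <= P (enum_val x))%N by rewrite /= ltnW.
rewrite -(PhiK (emb v) _ _ lP) -(PhiK (emb 0) _ _ lP).
(* By [Psi], it suffices that [v] and [0] have the same outputs at level [d] and
   above on the chains longer than [d]. *)
apply: (chain_map_long PsiP) => // j a dQ /andP[].
rewrite leq_eqVlt => /orP[/eqP da|da] aQ.
  have -> : a = l' by apply: val_inj.
  have jJ : j \in J by rewrite inE.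
  have := congr1 (fun r : 'rV[R]_#|J| => r 0 (enum_rank_in jJ j)) Tv.
  by rewrite !mxE enum_rankK_in.
apply: (chain_map_levels PhiP (d := d.+1)); last by rewrite da.
move=> i b /andP[db _]; rewrite !emb_level //.
all: by apply/eqP => E; move: db; rewrite E ltnn.
Qed.

(** * From control systems to chains *)

Lemma is_derive_within (R : realType) (k : nat) (y : R -> 'cV[R]_k)
    (v : 'cV[R]_k) (t : R) :
  0 < t ->
  (s - t)^-1 *: (y s - y t) @[s --> within `[0, +oo[ t^'] --> v ->
  forall a, is_derive t 1 (fun s => y s a 0) (v a 0).
Proof.
move=> t0 yv a.
have lim : h^-1 *: (((fun s => y s a 0) \o shift t) (h *: 1) - y t a 0)
    @[h --> 0^'] --> v a 0.
  have shiftF : (h + t) @[h --> 0^'] --> within `[0, +oo[ t^'.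
    move=> U; rewrite /within /= => /nbhs_ballP[e /= e0 eU].
    apply/nbhs_ballP; exists (Num.min e t); rewrite /= ?lt_min ?e0 // => h.
    rewrite /ball /= sub0r normrN lt_min => /andP[he ht] h0.
    apply: eU => /=.
    - by rewrite /ball /= opprD addrCA subrr addr0 normrN.
    - by rewrite -subr_eq0 addrK.
    - by rewrite in_itv /= andbT; move: ht; rewrite ltr_norml => /andP[]; lra.
  have ya : ((s - t)^-1 *: (y s - y t)) a 0 @[s --> within `[0, +oo[ t^'] --> v a 0.
    exact: cvg_entry.
  have := cvg_comp _ _ shiftF ya.
  rewrite [X in X @ _ --> _](_ : _ =
    fun h => h^-1 *: (((fun s => y s a 0) \o shift t) (h *: 1) - y t a 0)) //.
  by apply/funext => h; rewrite /= !mxE addrK /GRing.scale /= mulr1.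
apply: DeriveDef; first by apply/cvg_ex; exists (v a 0).
exact: cvg_lim lim.
Qed.

Lemma within_is_derive (R : realType) (k : nat) (y : R -> 'cV[R]_k)
    (v : 'cV[R]_k) (t : R) :
  (forall a, is_derive t 1 (fun s => y s a 0) (v a 0)) ->
  (s - t)^-1 *: (y s - y t) @[s --> within `[0, +oo[ t^'] --> v.
Proof.
move=> yv; apply: cvg_mx => a j; rewrite ord1.
have [d1 d2] := yv a.
have lim : h^-1 *: (((fun s => y s a 0) \o shift t) (h *: 1) - y t a 0)
    @[h --> 0^'] --> v a 0.
  by rewrite -d2; exact: d1.
have shiftF : (s - t) @[s --> within `[0, +oo[ t^'] --> 0^'.
  move=> U /nbhs_ballP[e /= e0 eU].
  apply/nbhs_ballP; exists e => //= s; rewrite /ball /= => ts st _.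
  by apply: eU; rewrite /ball /= ?sub0r ?opprB // subr_eq0.
rewrite (_ : (fun s => ((s - t)^-1 *: (y s - y t)) a 0) =
    (fun h => h^-1 *: (((fun s => y s a 0) \o shift t) (h *: 1) - y t a 0)) \o
    (fun s => s - t)); first exact: cvg_comp shiftF lim.
by apply/funext => s; rewrite /= !mxE /GRing.scale /= mulr1 subrK.
Qed.

(** State coordinate [a] sits at level [lv a] of chain [rw a]; the labels
    enumerate the levels [1], ..., [P i] of every chain [i], each of them once. *)
Definition chain_labels (k m : nat) (rw : 'I_k -> 'I_m) (lv : 'I_k -> nat)
    (P : 'I_m -> nat) :=
  [/\ forall a b, rw a = rw b -> lv a = lv b -> a = b,
      forall a, (0 < lv a <= P (rw a))%N,
      forall i l, (0 < l <= P i)%N -> exists2 a, rw a = i & lv a = l &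
      forall i, (P i <= k)%N].

Section Labels.
Variables (R : realType) (k m : nat) (rw : 'I_k -> 'I_m) (lv : 'I_k -> nat).

(** The system in which every coordinate is the derivative of the one above it in
    its chain, and the control drives level [1]. *)
Definition labelA : 'M[R]_k := \matrix_(a, b) ((rw a == rw b) && (lv a == (lv b).+1))%:R.
Definition labelB : 'M[R]_(k, m) := \matrix_(a, i) ((rw a == i) && (lv a == 1))%:R.

Definition decode (X : 'M[R]_(m, k.+1)) : 'cV[R]_k * 'cV[R]_m :=
  (\col_a X (rw a) (inord (lv a)), \col_i X i ord0).
Definition encode (z : 'cV[R]_k * 'cV[R]_m) : 'M[R]_(m, k.+1) :=
  \matrix_(i, l) if l == ord0 then z.2 i 0
                 else \sum_a (if (rw a == i) && (lv a == l) then z.1 a 0 else 0).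

Variable P : 'I_m -> nat.
Hypothesis labP : chain_labels rw lv P.

Let lv_ltn a : (lv a < k.+1)%N.
Proof.
by case: labP => _ /(_ a) /andP[_ lP] _ /(_ (rw a)) Pk; rewrite ltnS (leq_trans lP).
Qed.

Let lv_gt0 a : (0 < lv a)%N.
Proof. by case: labP => _ /(_ a) /andP[]. Qed.

Lemma decode_agree X Y : chain_agree P 0 X Y -> decode X = decode Y.
Proof.
move=> XY; congr (_, _); apply/colP => a; rewrite !mxE XY //.
by rewrite inordK //; case: labP => _ /(_ a) /andP[].
Qed.

Lemma decode_agree_state X Y : chain_agree P 1 X Y -> (decode X).1 = (decode Y).1.
Proof.
move=> XY; apply/colP => a; rewrite !mxE XY //.
by rewrite inordK //; case: labP => _ /(_ a).
Qed.

Lemma encode_label z a : encode z (rw a) (inord (lv a)) = z.1 a 0.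
Proof.
rewrite mxE -val_eqE /= inordK // gtn_eqF // (bigD1 a) //= !eqxx big1 ?addr0 // => b ba.
case: eqP => //= rba; case: eqP => // lba.
by case: labP ba => /(_ _ _ rba lba) -> _ _ _; rewrite eqxx.
Qed.

Lemma encodeK : cancel encode decode.
Proof.
move=> [x u]; congr (_, _); apply/colP => a; rewrite mxE; first by rewrite encode_label.
by rewrite mxE eqxx.
Qed.

Lemma decodeK X : chain_agree P 0 (encode (decode X)) X.
Proof.
move=> i l /= lP; have [->|l0] := eqVneq l ord0; first by rewrite !mxE eqxx.
have l_gt0 : (0 < l)%N by rewrite lt0n.
have [a ai al] : exists2 a, rw a = i & lv a = l.
  by case: labP => _ _ + _; apply; rewrite l_gt0.
have -> : l = inord (lv a) by apply: val_inj; rewrite al inord_val.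
by rewrite -ai encode_label mxE.
Qed.

Lemma decode_continuous : continuous decode.
Proof.
move=> X; apply: (@cvg_pair _ _ _ (nbhs X) (nbhs (decode X).1) (nbhs (decode X).2)).
  apply: (@cvg_mx R _ (nbhs X) (nbhs_filter X)) => a j; rewrite mxE.
  by under eq_fun do rewrite mxE; exact: coord_continuous.
apply: (@cvg_mx R _ (nbhs X) (nbhs_filter X)) => a j; rewrite mxE.
by under eq_fun do rewrite mxE; exact: coord_continuous.
Qed.

Lemma encode_continuous : continuous encode.
Proof.
move=> z; apply: (@cvg_mx R _ (nbhs z) (nbhs_filter z)) => i l; rewrite mxE.
under eq_fun do rewrite mxE.
case: (l == ord0).
  by apply: (@cvg_entry R _ (nbhs z) (nbhs_filter z)); exact: cvg_snd.
apply: (@cvg_fin_sum R _ (nbhs z) (nbhs_filter z)) => a.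
case: (_ && _); last exact: cvg_cst.
by apply: (@cvg_entry R _ (nbhs z) (nbhs_filter z)); exact: cvg_fst.
Qed.

(** Differentiation lowers the level by one, the control being at level [0]. *)
Lemma label_dynamics X a :
  (labelA *m (decode X).1 + labelB *m (decode X).2) a 0 = X (rw a) (inord (lv a).-1).
Proof.
rewrite !mxE (bigD1 (rw a)) //= [X in _ + (_ + X)]big1 ?addr0; last first.
  by move=> i ia; rewrite [labelB a i]mxE eq_sym (negbTE ia) mul0r.
rewrite !mxE eqxx /=.
have [la1|la1] := eqVneq (lv a) 1%N.
  rewrite big1 ?add0r ?mul1r ?la1 /=.
    by congr (X _ _); apply: val_inj; rewrite /= inordK.
  by move=> b _; rewrite [labelA a b]mxE la1 eqSS [0%N == _]eq_sym gtn_eqF // andbF mul0r.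
rewrite mul0r addr0.
have [b ba lb] : exists2 b, rw b = rw a & lv b = (lv a).-1.
  case: labP => _ /(_ a) laP + _; apply; have := lv_gt0 a; lia.
rewrite (bigD1 b) //= big1 ?addr0.
  by rewrite !mxE ba eqxx lb prednK // eqxx mul1r.
move=> c cb; rewrite [labelA a c]mxE; case: eqP => [rac|_]; last by rewrite mul0r.
case: eqP => [lac|_]; last by rewrite mul0r.
have cE : c = b.
  case: labP => + _ _ _; apply; first by rewrite ba.
  by rewrite lb lac.
by rewrite cE eqxx in cb.
Qed.

Lemma decode_flow_control X t : (decode (X *m flow_mx k t)).2 = (decode X).2.
Proof.
apply/colP => i; rewrite !mxE (bigD1 ord0) //= big1 ?addr0.
  by rewrite mxE /= subnn expr0 fact0 divr1 mulr1.
move=> a a0; rewrite mxE leqn0 (_ : (a == 0 :> nat)%N = false) ?mulr0n ?mulr0 //.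
exact: negbTE.
Qed.

Lemma decode_flow_solution X :
  is_solution labelA labelB (decode X).1 (fun=> (decode X).2)
    (fun t => (decode (X *m flow_mx k t)).1).
Proof.
split; first by rewrite flow_mx0 mulmx1.
move=> t _; apply: within_is_derive => a.
rewrite -(decode_flow_control X t) label_dynamics.
under [X in is_derive _ _ X _]eq_fun do rewrite mxE.
by apply: is_derive_flow; rewrite !inordK ?prednK //; have := lv_ltn a; lia.
Qed.

End Labels.

(** Only the trajectories with constant control, given by [flow_mx], are fed to
    the hypothesis. *)
Lemma brings_chain_map (R : realType) (k m : nat) (rw1 rw2 : 'I_k -> 'I_m)
    (lv1 lv2 : 'I_k -> nat) (P Q : 'I_m -> nat) H G :
  chain_labels rw1 lv1 P -> chain_labels rw2 lv2 Q ->
  brings H G (labelA R rw1 lv1) (labelB R rw1 lv1)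
    (labelA R rw2 lv2) (labelB R rw2 lv2) ->
  chain_map P Q (encode rw2 lv2 \o triangular_map H G \o decode rw1 lv1).
Proof.
move=> lab1 lab2 [Hc Gc HG]; split.
- have tc : continuous (triangular_map H G).
    move=> z; apply: (@cvg_pair _ _ _ (nbhs z) (nbhs (H z.1)) (nbhs (G z)) _ _ _
      (fun z => H z.1) G).
      by apply: (@continuous_cvg _ _ _ _ _ _ H); [exact: Hc|exact: cvg_fst].
    exact: Gc.
  move=> X; apply: (@continuous_comp _ _ _ (decode rw1 lv1)).
    exact: decode_continuous.
  apply: (@continuous_comp _ _ _ (triangular_map H G)); first exact: tc.
  exact: encode_continuous.
- case=> [|[|//]] X Y _ XY j l /andP[dl lQ].
    by rewrite /comp (decode_agree lab1 XY).
  rewrite !mxE (_ : (l == ord0) = false); last by apply/negbTE; rewrite -lt0n.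
  by rewrite /comp /triangular_map (decode_agree_state lab1 XY).
move=> X t j l l' t0 ll' lQ.
have [a ja al] : exists2 a, rw2 a = j & lv2 a = l.
  by case: lab2 => _ _ + _; apply; rewrite lQ andbT ll'.
have lE : l = inord (lv2 a) by apply: val_inj; rewrite al inord_val.
have l'E : l' = inord (lv2 a).-1 by apply: val_inj; rewrite al ll' inord_val.
have uc : {within `[0, +oo[, continuous ((fun=> (decode rw1 lv1 X).2) : R -> 'cV[R]_m)}.
  by apply: continuous_subspaceT => x; exact: cvg_cst.
have [_ sol] := HG _ _ _ uc (decode_flow_solution lab1 X).
have := is_derive_within t0 (sol t (ltW t0)) a.
set z := triangular_map H G (decode rw1 lv1 (X *m flow_mx k t)).
have -> : (labelA R rw2 lv2 *m H (decode rw1 lv1 (X *m flow_mx k t)).1 +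
    labelB R rw2 lv2 *m
      G ((decode rw1 lv1 (X *m flow_mx k t)).1, (decode rw1 lv1 X).2)) a 0 =
    encode rw2 lv2 z j l'.
  rewrite -(decode_flow_control rw1 lv1 X t) -surjective_pairing l'E -ja.
  by rewrite -(label_dynamics lab2) (encodeK lab2).
congr (is_derive _ _ _ _); apply/funext => s.
by rewrite /comp -ja lE (encode_label lab2).
Qed.

(** * The block-diagonal systems *)

Definition chain_length (m r : nat) (p : 'I_r -> nat) (i : 'I_m) : nat :=
  if insub (i : nat) is Some c then p c else 0.

Lemma chain_length_widen (m r : nat) (p : 'I_r -> nat) (rm : (r <= m)%N) (c : 'I_r) :
  chain_length p (widen_ord rm c) = p c.
Proof. by rewrite /chain_length (valK c). Qed.

Lemma chain_length_noninc (m r : nat) (p : 'I_r -> nat) :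
  (forall i j : 'I_r, (i <= j)%N -> (p j <= p i)%N) ->
  forall i j : 'I_m, (i <= j)%N -> (chain_length p j <= chain_length p i)%N.
Proof.
move=> pP i j ij; rewrite /chain_length.
case: insubP => // c _ cj; case: insubP => [b _ bi|]; first by apply: pP; rewrite cj bi.
by rewrite -leqNgt => /leq_trans-/(_ _ ij); rewrite -cj leqNgt ltn_ord.
Qed.

(** The [j]-th coordinate of a block of size [n], counted from [0], is at level
    [n - j]: the last one is driven by the control. *)
Lemma block_labels (R : realType) (k m r : nat) (p : 'I_r -> nat)
    (pk : (\sum_(i < r) p i)%N = k) (rm : (r <= m)%N) :
  exists (rw : 'I_k -> 'I_m) (lv : 'I_k -> nat),
    [/\ chain_labels rw lv (chain_length p),
        blockC R pk = labelA R rw lv & blockD R pk rm = labelB R rw lv].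
Proof.
case: _ / pk.
pose s1 a := @tagnat.sig1 r p a; pose s2 a := @tagnat.sig2 r p a.
exists (fun a => widen_ord rm (s1 a)), (fun a => (p (s1 a) - s2 a)%N).
have s2_lt a : (s2 a < p (s1 a))%N by [].
split.
- split.
  + move=> a b /(congr1 val) /= s1ab lvab.
    have s1E : s1 a = s1 b by apply: val_inj.
    rewrite -(tagnat.sig2K a) -(tagnat.sig2K b); apply: val_inj; apply/eqP.
    rewrite tagnat.eq_Rank; apply/andP; split; first exact/eqP.
    have := congr1 p s1E; have := s2_lt a; have := s2_lt b.
    by move: lvab; rewrite /s2; lia.
  + by move=> a; rewrite chain_length_widen; have := s2_lt a; lia.
  + move=> i l; rewrite /chain_length; case: insubP => [c _ ci|]; last by lia.
    move=> /andP[l0 lp]; have lp' : (p c - l < p c)%N by lia.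
    exists (tagnat.Rank c (Ordinal lp')).
      by apply: val_inj; rewrite /= /s1 tagnat.Rank1K.
    by rewrite /s1 /s2 tagnat.Rank2K /= tagnat.Rank1K subKn.
  + move=> i; rewrite /chain_length; case: insubP => // c _ _.
    by rewrite (bigD1 c) //= leq_addr.
- have entry (i j : 'I_r) (x : 'I_(p i)) (y : 'I_(p j)) :
      (if i == j then conform_mx 0 (shift_mx R (p i)) else 0) x y =
      ((i == j) && (p i - x == (p j - y).+1)%N)%:R :> R.
    case: (eqVneq i j) y => [<-|_] y; last by rewrite mxE.
    have -> : (p i - x == (p i - y).+1)%N = (y == x.+1 :> nat).
      by have := ltn_ord x; have := ltn_ord y; move: (p i) (x : nat) (y : nat); lia.
    by rewrite conform_mx_id mxE.
  rewrite /blockC castmx_id; apply/matrixP => a b; rewrite !mxE.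
  by rewrite entry [widen_ord _ _ == _](_ : _ = (s1 a == s1 b)) // -val_eqE.
- rewrite /blockD castmx_id; apply/matrixP => a u; rewrite !mxE.
  rewrite -/(s1 a) -/(s2 a) big_ord1 !mxE eqxx /= -natrM mulnb [_ == u]eq_sym andbC.
  have -> : (p (s1 a) - s2 a == 1)%N = ((s2 a).+1 == p (s1 a)).
    by move: (s2_lt a); move: (p (s1 a)) (s2 a : nat); lia.
  by [].
Qed.

(** If [P i < Q i], the chains [j] with [P i < P j] come before [i], so they also
    satisfy [P i < Q j]; as [i] itself does too, there are strictly more such [j]
    for [Q]. *)
Lemma noninc_count_le (m k : nat) (P Q : 'I_m -> nat) :
  (forall i j : 'I_m, (i <= j)%N -> (P j <= P i)%N) ->
  (forall i j : 'I_m, (i <= j)%N -> (Q j <= Q i)%N) ->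
  (forall i, (Q i <= k)%N) ->
  (forall d, (d < k)%N ->
    (#|[pred i | (d < Q i)%N]| <= #|[pred i | (d < P i)%N]|)%N) ->
  forall i, (Q i <= P i)%N.
Proof.
move=> Pni Qni Qk count i; rewrite leqNgt; apply/negP => PQ.
have := count _ (leq_trans PQ (Qk i)); rewrite leqNgt => /negP; apply.
apply: proper_card; apply/properP; split; last by exists i; rewrite !inE ?PQ ?ltnn.
apply/fintype.subsetP => j; rewrite !inE => PiPj.
have [ji|ij] := leqP j i; first exact: leq_trans PQ (Qni _ _ ji).
by move: PiPj; rewrite ltnNge Pni // ltnW.
Qed.

Lemma equivalence_count (R : realType) (k m : nat) (rw1 rw2 : 'I_k -> 'I_m)
    (lv1 lv2 : 'I_k -> nat) (P Q : 'I_m -> nat) (d : nat) : (d < k)%N ->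
  chain_labels rw1 lv1 P -> chain_labels rw2 lv2 Q ->
  topologically_equivalent
    (labelA R rw1 lv1) (labelB R rw1 lv1) (labelA R rw2 lv2) (labelB R rw2 lv2) ->
  #|[pred i | (d < P i)%N]| = #|[pred i | (d < Q i)%N]|.
Proof.
move=> dk lab1 lab2 [H [G [Hinv [W [[_ _ FK WK] _ _ b12 b21]]]]].
have c12 := brings_chain_map lab1 lab2 b12.
have c21 := brings_chain_map lab2 lab1 b21.
apply/eqP; rewrite eqn_leq; apply/andP; split.
  apply: (chain_map_count dk c12 c21) => X.
  by rewrite /comp (encodeK lab2) FK; exact: decodeK.
apply: (chain_map_count dk c21 c12) => X.
by rewrite /comp (encodeK lab1) WK; exact: decodeK.
Qed.

Lemma linearly_equivalent_refl (R : realType) (k m : nat) (A : 'M[R]_k)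
    (B : 'M[R]_(k, m)) :
  linearly_equivalent A B A B.
Proof.
have b : brings id snd A B A B.
  by split=> // z; [exact: cvg_id|exact: cvg_snd].
have tE : triangular_map id snd = id :> ('cV[R]_k * 'cV[R]_m -> _).
  by apply/funext => -[].
exists id, snd; split; last by rewrite tE.
exists id, snd; split=> //.
by rewrite tE; split=> // z; exact: cvg_id.
Qed.

Lemma blocks_eq (R : realType) (k m r s : nat) (p : 'I_r -> nat) (q : 'I_s -> nat)
    (p_ge1 : forall i, (1 <= p i)%N) (q_ge1 : forall i, (1 <= q i)%N)
    (rm : (r <= m)%N) (sm : (s <= m)%N)
    (pk : (\sum_(i < r) p i)%N = k) (qk : (\sum_(i < s) q i)%N = k) :
  (forall i : 'I_m, chain_length p i = chain_length q i) ->
  blockC R pk = blockC R qk /\ blockD R pk rm = blockD R qk sm.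
Proof.
move=> pq.
have le_rs (r' s' : nat) (p' : 'I_r' -> nat) (q' : 'I_s' -> nat) : (r' <= m)%N ->
    (forall i, (1 <= p' i)%N) ->
    (forall i : 'I_m, chain_length p' i = chain_length q' i) -> (r' <= s')%N.
  move=> r'm p'1 pq'; rewrite leqNgt; apply/negP => sr.
  have := p'1 (Ordinal sr); rewrite -(chain_length_widen p' r'm) pq' /chain_length.
  by rewrite insubF //= ltnn.
have rs : r = s by apply/eqP; rewrite eqn_leq (le_rs _ _ p q) // (le_rs _ _ q p).
subst s.
have pqE : p = q.
  apply/funext => c; by rewrite -(chain_length_widen p rm) pq chain_length_widen.
subst q; rewrite (eq_irrelevance pk qk) (eq_irrelevance rm sm); by [].
Qed.

Theorem proposition5p5 (R : realType) (k m r s : nat)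
    (p : 'I_r -> nat) (q : 'I_s -> nat)
    (k_ge1 : (1 <= k)%N) (m_ge1 : (1 <= m)%N)
    (p_ge1 : forall i : 'I_r, (1 <= p i)%N)
    (q_ge1 : forall i : 'I_s, (1 <= q i)%N)
    (p_noninc : forall i j : 'I_r, (i <= j)%N -> (p j <= p i)%N)
    (q_noninc : forall i j : 'I_s, (i <= j)%N -> (q j <= q i)%N)
    (r_le_m : (r <= m)%N) (s_le_m : (s <= m)%N)
    (p_sum : (\sum_(i < r) p i)%N = k) (q_sum : (\sum_(i < s) q i)%N = k) :
  topologically_equivalent
    (blockC R p_sum) (blockD R p_sum r_le_m)
    (blockC R q_sum) (blockD R q_sum s_le_m) ->
  linearly_equivalent
    (blockC R p_sum) (blockD R p_sum r_le_m)
    (blockC R q_sum) (blockD R q_sum s_le_m).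
Proof.
move=> top.
have [rw1 [lv1 [lab1 C1 D1]]] := block_labels R p_sum r_le_m.
have [rw2 [lv2 [lab2 C2 D2]]] := block_labels R q_sum s_le_m.
have count d (dk : (d < k)%N) :
    #|[pred i : 'I_m | (d < chain_length p i)%N]| =
    #|[pred i : 'I_m | (d < chain_length q i)%N]|.
  by move: top; rewrite C1 C2 D1 D2; exact: equivalence_count.
have [_ _ _ pk] := lab1; have [_ _ _ qk] := lab2.
have [-> ->] : blockC R p_sum = blockC R q_sum /\
    blockD R p_sum r_le_m = blockD R q_sum s_le_m.
  apply: blocks_eq => // i; apply/eqP; rewrite eqn_leq; apply/andP; split.
    apply: (noninc_count_le _ _ pk) => [||d dk]; last by rewrite count.
      exact: chain_length_noninc.
    exact: chain_length_noninc.
  apply: (noninc_count_le _ _ qk) => [||d dk]; last by rewrite count.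
    exact: chain_length_noninc.
  exact: chain_length_noninc.
exact: linearly_equivalent_refl.
Qed.
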